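(* Let $k$ be a field of characteristic zero and let $e\in\{4,5\}$. For a positive integer $r$, let $f_e(r)$ be the least integer $a$ such that there is a Gorenstein Hilbert function $(1,h_1,h_2,\dots,h_e)$ of socle degree $e$ with $h_1=r$ and $h_2=a$. Then the Gorenstein Interval Conjecture holds in socle degree $e$ if and only if $f_e$ is a nondecreasing function of $r$.
   Context: Fix a field $k$ of characteristic zero. A standard graded artinian algebra is $A=R/I$ with $R=k[x_1,\dots,x_r]$, all variables of degree one, $I$ a homogeneous ideal containing no nonzero linear forms, and $\dim_k A<\infty$; $r$ is the codimension of $A$. The Hilbert function of $A$ is $h_j=\dim_k A_j$, identified with the vector $(1,h_1,\dots,h_e)$, where $e$ (the socle degree) is the largest index with $h_e>0$. The socle of $A$ is the annihilator of the maximal ideal $(\overline{x_1},\dots,\overline{x_r})$ in $A$; $A$ is Gorenstein if its socle is one-dimensional over $k$ (hence concentrated in degree $e$). A sequence is a Gorenstein Hilbert function (of socle degree $e$) if it is the Hilbert function of some such Gorenstein algebra $A$ over $k$ (of socle degree $e$). The Gorenstein Interval Conjecture (GIC) holds in socle degree $e$ if the following is true for every $1\le i\le e-1$, every integer $\alpha\ge2$ and every integer sequence $h=(1,h_1,\dots,h_{e-1},1)$ indexed by $0,\dots,e$: writing $h^{(\beta)}$ for the sequence obtained from $h$ by replacing $h_j$ with $h_j+\beta$ for each $j\in\{i,e-i\}$ (one entry only, increased once, if $i=e-i$) and leaving all other entries unchanged, if $h$ and $h^{(\alpha)}$ are both Gorenstein Hilbert functions, then $h^{(\beta)}$ is a Gorenstein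 Hilbert function for every $\beta=1,\dots,\alpha-1$. *)

(* Defs.v *)
From Stdlib Require Import ClassicalEpsilon.
From HB Require Import structures.
From mathcomp Require Import all_boot all_order all_algebra.
From mathcomp Require Import mpoly.

Set Implicit Arguments.
Unset Strict Implicit.
Unset Printing Implicit Defensive.

Import GRing.Theory.

Local Open Scope ring_scope.

(* The quotient of U by W (more precisely U / (U :&: W), the image of U in
   V / W) has dimension n: the classes of b form a basis of it. *)
Definition quot_dim (k : fieldType) (V : lmodType k) (U W : V -> Prop)
    (n : nat) : Prop :=
  exists b : 'I_n -> V,
    [/\ forall i, U (b i),
        forall c : 'I_n -> k, W (\sum_i c i *: b i) -> forall i, c i = 0 &
        forall u, U u -> exists c : 'I_n -> k, W (u - \sum_i c i *: b i)].

Section GradedAlgebra.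

Variables (k : fieldType) (r : nat).
Implicit Types (p q l : {mpoly k[r]}) (I : {pred {mpoly k[r]}}).

Definition homogeneous_pred I : Prop :=
  forall p, p \in I -> forall d, pihomog mdeg d p \in I.

Definition standard_graded_artinian I : Prop :=
  [/\ idealr_closed I,
      homogeneous_pred I,
      forall l, l \is 1.-homog -> l \in I -> l = 0 &
      exists n, quot_dim (fun=> True) (fun p => p \in I) n].

Definition is_hilbert_function I (h : nat -> nat) : Prop :=
  forall j, quot_dim (fun p => p \is j.-homog) (fun p => p \in I) (h j).

Definition irrelevant_ideal q : Prop :=
  exists c : 'I_r -> {mpoly k[r]}, q = \sum_i c i * 'X_i.

(* Polynomials whose class modulo I is in the socle of the quotient by I. *)
Definition socle I p : Prop := forall q, irrelevant_ideal q -> q * p \in I.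

Definition gorenstein I : Prop := quot_dim (socle I) (fun p => p \in I) 1.

End GradedAlgebra.

Definition is_socle_degree (h : nat -> nat) (e : nat) : Prop :=
  (0 < h e)%N /\ forall j, (e < j)%N -> h j = 0%N.

(* A vector (h_0, ..., h_e) is encoded as h : nat -> nat vanishing past e. *)
Definition gorenstein_hf (k : fieldType) (e : nat) (h : nat -> nat) : Prop :=
  exists (r : nat) (I : {pred {mpoly k[r]}}),
    [/\ standard_graded_artinian I, gorenstein I,
        is_hilbert_function I h & is_socle_degree h e].

Definition raise (e i b : nat) (h : nat -> nat) : nat -> nat :=
  fun j => if (j == i) || (j == e - i)%N then (h j + b)%N else h j.

Definition GIC (k : fieldType) (e : nat) : Prop :=
  forall (i a : nat) (h : nat -> nat),
    (1 <= i <= e - 1)%N -> (2 <= a)%N -> h 0%N = 1%N -> h e = 1%N ->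
    gorenstein_hf k e h -> gorenstein_hf k e (raise e i a h) ->
    forall b, (1 <= b <= a - 1)%N -> gorenstein_hf k e (raise e i b h).

Definition is_least (P : nat -> Prop) (a : nat) : Prop :=
  P a /\ forall b, P b -> (a <= b)%N.

(* epsilon picks the least element of a nonempty set of naturals; its value is
   unspecified on the empty set. *)
Definition f (k : fieldType) (e r : nat) : nat :=
  epsilon (inhabits 0%N)
    (is_least (fun a => exists h : nat -> nat,
       [/\ gorenstein_hf k e h, h 0%N = 1%N, h 1%N = r & h 2%N = a])).

(* Main.v *)
Require Import Defs.
From mathcomp Require Import all_boot all_order all_algebra.
From Stdlib Require Import ClassicalEpsilon.
From HB Require Import structures.
From mathcomp Require Import mpoly zify.

Set Implicit Arguments.
Unset Strict Implicit.
Unset Printing Implicit Defensive.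

Import GRing.Theory.

(* By Macaulay duality a Gorenstein quotient of k[x_1..x_r] of socle degree e
   is the quotient by the annihilator of a functional g on the forms of
   degree e, and h_j is the rank of the catalecticant matrix
   (g(m m'))_{deg m = j, deg m' = e - j}; in particular h is symmetric, so for
   e = 4, 5 it is determined by (h_1, h_2).

   Every functional is a combination of evaluations at points, whose
   catalecticants have rank one.  Moving from g along g + s g' one evaluation
   of g' at a time, with s generic, never lowers h_1, changes h_2 by at most
   one per step, and ends with h_2 at least that of g'.  Since g' may also come
   from fewer variables, (r, b) is attained as soon as f(r) <= b <= c with
   (r', c) attained for some r' <= r; this gives the conjecture from the
   monotonicity of f.  Conversely if a = f(s) < f(r) with r < s, then
   a < r because f(r) <= r (power sums), and the conjecture applied between
   the power sum vector (1,a,a,..) and (1,s,a,..) shows that (r, a) is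
   attained, a contradiction. *)

(** * Ranks along pencils of matrices, and polynomials over a field of characteristic zero *)

Section MatrixRank.
Local Open Scope ring_scope.
Variable k : fieldType.

Lemma mxrank_mxsub m n p q (f : 'I_p -> 'I_m) (g : 'I_q -> 'I_n)
    (A : 'M[k]_(m, n)) : (\rank (mxsub f g A) <= \rank A)%N.
Proof.
have -> : mxsub f g A = (rowsub f 1%:M *m A) *m colsub g 1%:M.
  by rewrite mul_rowsub_mx mul1mx mulmx_colsub mulmx1; apply/matrixP=> i j; rewrite !mxE.
exact: leq_trans (mxrankM_maxl _ _) (mxrankM_maxr _ _).
Qed.

(** The factors of the full rank factorisation [mulmx_base] have one-sided inverses. The pair [L],
    [R] plays the role of a nonvanishing maximal minor. *)
Lemma mxrank_witness m n (A : 'M[k]_(m, n)) :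
  exists L R, L *m A *m R = 1%:M :> 'M_(\rank A).
Proof.
have /row_fullP[L hL] := col_base_full A.
have /row_freeP[R hR] := row_base_free A.
exists L, R; rewrite -[X in L *m X](mulmx_base A) mulmxA hL mul1mx.
exact: hR.
Qed.

Lemma mxrank_ge_det n m p (A : 'M[k]_(m, n)) (L : 'M_(p, m)) (R : 'M_(n, p)) :
  \det (L *m A *m R) != 0 -> (p <= \rank A)%N.
Proof.
rewrite -unitfE -/(unitmx (L *m A *m R)) => /mxrank_unit {1}<-.
exact: leq_trans (mxrankM_maxl _ _) (mxrankM_maxr _ _).
Qed.

Definition pencil_det n (C D : 'M[k]_n) : {poly k} :=
  \det (map_mx polyC C + 'X *: map_mx polyC D).

Lemma horner_pencil_det n (C D : 'M[k]_n) t :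
  (pencil_det C D).[t] = \det (C + t *: D).
Proof.
rewrite /pencil_det -/(horner_eval t _) -det_map_mx; congr (\det _).
by apply/matrixP => i j; rewrite !mxE /= horner_evalE !hornerE.
Qed.

(** The minor witnessing the rank of [A] becomes a polynomial in [t] with value 1 at [t = 0]; off
    its roots it still bounds the rank from below. *)
Lemma mxrank_pencil m n (A B : 'M[k]_(m, n)) :
  exists2 q : {poly k}, q != 0 &
    forall t, q.[t] != 0 -> (\rank A <= \rank (A + t *: B)%R)%N.
Proof.
have [L [R hLR]] := mxrank_witness A.
exists (pencil_det (L *m A *m R) (L *m B *m R)).
  apply: contra_neq (oner_neq0 k) => q0.
  by have := horner_pencil_det (L *m A *m R) (L *m B *m R) 0;
     rewrite q0 horner0 scale0r addr0 hLR det1.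
move=> t; rewrite horner_pencil_det => ht; apply (@mxrank_ge_det _ _ _ (A + t *: B) L R).
by rewrite mulmxDr mulmxDl -scalemxAr -scalemxAl.
Qed.

(** A witness for [B] turns the minor of the pencil into the determinant of [L *m A *m R + t], a
    characteristic polynomial, hence monic and nonzero. *)
Lemma mxrank_pencil_top m n (A B : 'M[k]_(m, n)) :
  exists2 q : {poly k}, q != 0 &
    forall t, q.[t] != 0 -> (\rank B <= \rank (A + t *: B)%R)%N.
Proof.
have [L [R hLR]] := mxrank_witness B.
exists (char_poly (- (L *m A *m R))); first exact/monic_neq0/char_poly_monic.
move=> t; have -> : char_poly (- (L *m A *m R)) = pencil_det (L *m A *m R) 1%:M.
  rewrite /char_poly /char_poly_mx /pencil_det map_mx1 map_mxN opprK.
  by rewrite scalemx1 addrC.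
rewrite horner_pencil_det -{1}hLR => ht.
apply (@mxrank_ge_det _ _ _ (A + t *: B) L R).
by rewrite mulmxDr mulmxDl -scalemxAr -scalemxAl.
Qed.

Hypothesis k0 : [pchar k] =i pred0.

Lemma pchar0_natr_inj : injective (fun n : nat => n%:R : k).
Proof.
move=> m n /= /eqP; wlog le_mn : m n / (m <= n)%N.
  by move=> H; case/orP: (leq_total m n) => /H // h mn; apply/esym/h; rewrite eq_sym.
by rewrite eq_sym -subr_eq0 -natrB // ((pcharf0P k).1 k0) subn_eq0 => h; lia.
Qed.

Lemma poly_vanish_eq0 (p : {poly k}) n : (size p <= n)%N ->
  (forall t, (t < n)%N -> p.[t%:R] = 0) -> p = 0.
Proof.
move=> sp hp; apply: (@roots_geq_poly_eq0 _ _ [seq t%:R : k | t <- iota 0 n]).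
- by apply/allP => _ /mapP[t + ->]; rewrite mem_iota => /hp /rootP.
- by rewrite map_inj_uniq ?iota_uniq //; exact: pchar0_natr_inj.
- by rewrite size_map size_iota.
Qed.

Lemma poly_nonroot (p : {poly k}) : p != 0 -> exists t, p.[t] != 0.
Proof.
move=> p0; apply: NNPP => H; move/eqP: p0; apply.
apply: (poly_vanish_eq0 (leqnn _)) => t _; apply/eqP; apply: contraT => h.
by case: H; exists t%:R.
Qed.

End MatrixRank.

(** Reduction modulo [N] identifies the lowest digits; after cancelling them and dividing by [N],
    induction applies. *)
Lemma base_expansion_inj N r (u v : 'I_r -> nat) :
  (forall i, u i < N) -> (forall i, v i < N) ->
  \sum_(i < r) u i * N ^ i = \sum_(i < r) v i * N ^ i -> u =1 v.
Proof.
elim: r u v => [|r IH] u v hu hv; first by move=> _ [].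
rewrite !big_ord_recl /= !expn0 !muln1.
have E (w : 'I_r.+1 -> nat) : \sum_(i < r) w (lift ord0 i) * N ^ (bump 0 i)
    = (\sum_(i < r) w (lift ord0 i) * N ^ i) * N.
  by rewrite big_distrl; apply: eq_bigr => i _ /=; rewrite expnS mulnCA mulnC.
rewrite !E => h.
have h0 : u ord0 = v ord0.
  by have := congr1 (modn^~ N) h; rewrite /= ![_ ord0 + _]addnC !modnMDl !modn_small.
have hN : 0 < N by apply: leq_ltn_trans (hu ord0).
move: h; rewrite h0 => /addnI /eqP; rewrite eqn_pmul2r // => /eqP /IH hS i.
case: (unliftP ord0 i) => [j ->|->] //.
by apply: (hS _ _ j) => ?.
Qed.

Lemma mnm_leq_mdeg r (m : 'X_{1..r}) i : m i <= mdeg m.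
Proof. by rewrite mdegE (bigD1 i) //= leq_addr. Qed.

(** * Catalecticant matrices and interpolation of their ranks *)

Section Catalecticant.
Local Open Scope ring_scope.
Variables (k : fieldType) (e r : nat).
Implicit Types (g : 'X_{1..r} -> k) (j : nat).

Definition mon (a : 'I_#|{: 'X_{1..r < e.+1}}|) : 'X_{1..r} := bmnm (enum_val a).

Lemma mdeg_mon a : (mdeg (mon a) <= e)%N.
Proof. by rewrite -ltnS /mon bmdeg. Qed.

Lemma monP m : (mdeg m <= e)%N -> exists a, mon a = m.
Proof.
rewrite -ltnS => h; exists (enum_rank (BMultinom h)).
by rewrite /mon enum_rankK.
Qed.

Lemma mon_inj : injective mon.
Proof. by move=> a b /val_inj/enum_val_inj. Qed.

(* Indexed by all monomials of degree at most e; the entries outside the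
   degree (j, e - j) block are zero and do not affect the rank. *)
Definition catmx g j : 'M[k]_#|{: 'X_{1..r < e.+1}}| := \matrix_(a, b)
  if (mdeg (mon a) == j) && (mdeg (mon a) + mdeg (mon b) == e)%N
  then g (mon a + mon b)%MM else 0.

Lemma eq_catmx g g' j : (forall m, mdeg m = e -> g m = g' m) -> catmx g j = catmx g' j.
Proof.
move=> h; apply/matrixP => a b; rewrite !mxE; case: ifP => // /andP[_ /eqP hab].
by rewrite h // mdegD.
Qed.

Lemma catmxD g c g' j : catmx (fun m => g m + c * g' m) j = catmx g j + c *: catmx g' j.
Proof.
by apply/matrixP => a b; rewrite !mxE; case: ifP => _; rewrite ?mulr0 ?addr0.
Qed.

Lemma catmx_tr g j : (j <= e)%N -> (catmx g j)^T = catmx g (e - j).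
Proof.
move=> je; apply/matrixP => a b; rewrite !mxE addmC.
have := mdeg_mon a; have := mdeg_mon b; rewrite [(mdeg (mon b) + _)%N]addnC.
by case: eqP => ? /=; case: eqP => ? //=; case: eqP => ? //=; lia.
Qed.

Lemma mxrank_catmx_sym g j : (j <= e)%N -> \rank (catmx g (e - j)) = \rank (catmx g j).
Proof. by move=> je; rewrite -catmx_tr // mxrank_tr. Qed.

Lemma catmx_gt g j : (e < j)%N -> catmx g j = 0.
Proof.
move=> je; apply/matrixP => a b; rewrite !mxE.
by have := mdeg_mon a; case: eqP => //= ?; lia.
Qed.

(** Multiplicativity splits each entry as row factor times column factor, so the matrix is an outer
    product. *)
Lemma mxrank_catmx_mul (w : 'X_{1..r} -> k) j :
  (forall m m', w (m + m')%MM = w m * w m') -> (\rank (catmx w j) <= 1)%N.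
Proof.
move=> hw; have -> : catmx w j =
    (\col_a if mdeg (mon a) == j then w (mon a) else 0) *m
    (\row_b if (j + mdeg (mon b) == e)%N then w (mon b) else 0).
  apply/matrixP => a b; rewrite !mxE big_ord1 !mxE.
  by case: eqP => [->|] /=; case: eqP; rewrite ?hw ?mulr0 ?mul0r.
exact: leq_trans (mxrankM_maxl _ _) (rank_leq_col _).
Qed.

(** Kronecker substitution: the exponent of [t] in the value of the monomial at (t, t^N, t^(N^2),
    ...), where [N = e.+1]. *)
Definition mcode (m : 'X_{1..r}) : nat := \sum_(i < r) m i * e.+1 ^ i.

Lemma mcodeD m m' : mcode (m + m')%MM = (mcode m + mcode m')%N.
Proof.
by rewrite /mcode -big_split; apply: eq_bigr => i _; rewrite mnmDE mulnDl.
Qed.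

Lemma mcode_mon_inj : injective (mcode \o mon).
Proof.
have hlt a i : (mon a i < e.+1)%N.
  by rewrite ltnS (leq_trans (mnm_leq_mdeg _ _) (mdeg_mon a)).
by move=> a b /= /(base_expansion_inj (hlt a) (hlt b)) h; apply/mon_inj/mnmP.
Qed.

Hypothesis k0 : [pchar k] =i pred0.

(* Evaluation at the point (t, t^N, t^(N^2), ...) with N = e + 1 separates
   monomials of degree at most e, by uniqueness of base-N expansions. *)
Lemma evaluations_span g : exists K (c : 'I_K -> k),
  forall m, (mdeg m <= e)%N -> g m = \sum_(t < K) c t * t%:R ^+ mcode m.
Proof.
pose K := (\max_a mcode (mon a)).+1.
pose E : 'M[k]_(K, _) := \matrix_(t, a) (t : nat)%:R ^+ mcode (mon a).
have ltK a : (mcode (mon a) < K)%N.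
  by rewrite ltnS (leq_bigmax (F := mcode \o mon)).
(* A linear relation [x] between the columns of [E] is a polynomial of size at most [K] vanishing at
   0, ..., [K - 1], hence zero; as [mcode] is injective on these monomials, its coefficients are the
   entries of [x]. *)
have /row_fullP[B hB] : row_full E.
  rewrite -[row_full E]/(_ == _) -mxrank_tr -/(row_free _) -kermx_eq0.
  apply/rowV0P => x /sub_kermxP hx.
  pose p : {poly k} := \sum_a x 0 a *: 'X^(mcode (mon a)).
  have p0 : p = 0.
    apply: (poly_vanish_eq0 k0 (n := K)).
      apply/(leq_trans (size_sum _ _ _))/bigmax_leqP => a _.
      by rewrite (leq_trans (size_scale_leq _ _)) // size_polyXn.
    move=> t tK; move/matrixP/(_ 0 (Ordinal tK)): hx; rewrite !mxE => <-.
    rewrite horner_sum; apply: eq_bigr => a _.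
    by rewrite hornerZ hornerXn !mxE.
  apply/rowP => a; rewrite mxE; move: (congr1 (fun q : {poly k} => q`_(mcode (mon a))) p0).
  rewrite coef0 coef_sum (bigD1 a) //= coefZ coefXn eqxx mulr1 big1 ?addr0 //.
  move=> b ba; rewrite coefZ coefXn; case: eqP => [/mcode_mon_inj h|]; last by rewrite mulr0.
  by rewrite h eqxx in ba.
exists K, (fun t => ((\row_a g (mon a)) *m B) 0 t) => m /monP[a <-].
have /rowP/(_ a) : (\row_a g (mon a)) *m B *m E = \row_a g (mon a).
  by rewrite -mulmxA hB mulmx1.
by rewrite !mxE => {1}<-; apply: eq_bigr => t _; rewrite !mxE.
Qed.

Lemma catmx_interpolation g g' i j b :
  (\rank (catmx g j) <= b <= \rank (catmx g' j))%N ->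
  exists2 g'', (\rank (catmx g i) <= \rank (catmx g'' i))%N &
               \rank (catmx g'' j) = b.
Proof.
case/andP => gb bg'.
have [K [c hc]] := evaluations_span g'.
pose w (t : nat) m : k := t%:R ^+ mcode m.
pose G n m := \sum_(t < K | (t < n)%N) c t * w t m.
have /fin_all_exists2[q q0 hq] :=
  fun n : 'I_K.+1 => mxrank_pencil (catmx g i) (catmx (G n) i).
have [q' q'0 hq'] := mxrank_pencil_top (catmx g j) (catmx g' j).
have [s] : exists s, (q' * \prod_(n < K.+1) q n).[s] != 0.
  apply: poly_nonroot => //; rewrite mulf_neq0 //.
  exact/prodf_neq0.
rewrite hornerM mulf_eq0 negb_or => /andP[/hq' sq'].
rewrite horner_prod => /prodf_neq0 sq.
pose F n m := g m + s * G n m.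
have G0 m : G 0%N m = 0 by rewrite /G big_pred0.
have FK : (b <= \rank (catmx (F K) j))%N.
  apply: leq_trans bg' _; apply: leq_trans sq' _; rewrite -catmxD.
  rewrite (@eq_catmx _ (F K)) // => m hm; rewrite /F hc ?hm //.
  by congr (_ + _ * _); apply: eq_big => [t|t _] //; rewrite ltn_ord.
have step n : (n < K)%N ->
    (\rank (catmx (F n.+1) j) <= (\rank (catmx (F n) j)).+1)%N.
  move=> nK; pose o := Ordinal nK.
  have -> : catmx (F n.+1) j = catmx (F n) j + (s * c o) *: catmx (w n) j.
    rewrite -catmxD; apply: eq_catmx => m _; rewrite /F /G -addrA; congr (_ + _).
    rewrite (bigD1 o) /=; last by [].
    rewrite -mulrA -mulrDr addrC; congr (_ * (_ + _)).
    apply: eq_bigl => t; rewrite -val_eqE /=; lia.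
  apply: leq_trans (mxrank_add _ _) _; rewrite -[X in (_ <= X)%N]addn1 leq_add2l.
  apply: leq_trans (mxrank_scale _ _) _.
  by apply: mxrank_catmx_mul => m m'; rewrite /w mcodeD exprD.
have ex : exists n, (b <= \rank (catmx (F n) j))%N by exists K.
have [n hn nmin] := ex_minnP ex.
have nK : (n < K.+1)%N by rewrite ltnS nmin.
exists (F n).
  by rewrite catmxD; apply: (hq (Ordinal nK)); exact: sq.
apply/eqP; rewrite eqn_leq hn andbT.
(* The first index reaching [b] cannot overshoot it: at 0 the rank is that of [g], and otherwise the
   previous rank was below [b] and grew by at most one. *)
case: n nK nmin {hn} => [|n] nK nmin.
  by rewrite (@eq_catmx _ g) // => m _; rewrite /F G0 mulr0 addr0.
apply: leq_trans (step n nK) _; rewrite ltnNge.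
by apply/negP => /nmin; rewrite ltnn.
Qed.

End Catalecticant.

(** * Dimensions of quotients as matrix ranks, and their uniqueness *)

Section QuotientDimension.
Local Open Scope ring_scope.
Variables (k : fieldType) (V : lmodType k).
Implicit Types U W : V -> Prop.

(** The relations modulo [W] between the generators [u] are those between the rows of [M], so the
    generators indexed by a maximal free set of rows form a basis. *)
Lemma quot_dim_rank U W m n (u : 'I_m -> V) (M : 'M[k]_(m, n)) :
  (forall i, U (u i)) -> (forall x y, W x -> W y -> W (x + y)) ->
  (forall v, U v -> exists c : 'rV_m, W (v - \sum_i c 0 i *: u i)) ->
  (forall c : 'rV_m, W (\sum_i c 0 i *: u i) <-> c *m M = 0) ->
  quot_dim U W (\rank M).
Proof.
move=> hU hW spanU kerW.
pose s := maxrankfun M; pose S : 'M[k]_(_, m) := rowsub s 1%:M.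
have SM : S *m M = rowsub s M by rewrite mul_rowsub_mx mul1mx.
have sumS (c : 'I_(\rank M) -> k) :
    \sum_i c i *: u (s i) = \sum_j ((\row_i c i) *m S) 0 j *: u j.
  under [RHS]eq_bigr => j _ do rewrite mxE scaler_suml.
  rewrite exchange_big; apply: eq_bigr => i _ /=.
  rewrite (bigD1 (s i)) //= !mxE eqxx mulr1 big1 ?addr0 // => j ji.
  by rewrite !mxE eq_sym (negPf ji) mulr0 scale0r.
exists (u \o s); split=> [i|c|v Uv] /=; first exact: hU.
  rewrite sumS => /kerW; rewrite -mulmxA SM => h.
  have c0 : \row_i c i = 0 by apply: (row_free_inj (maxrowsub_free M)); rewrite h mul0mx.
  by move=> i; move/rowP/(_ i): c0; rewrite !mxE.
have [c hc] := spanU v Uv.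
have /submxP[d hd] : (c *m M <= rowsub s M)%MS.
  by rewrite (eq_maxrowsub M) submxMl.
exists (fun i => d 0 i); rewrite sumS.
have -> : \row_i d 0 i = d by apply/rowP => i; rewrite mxE.
have /kerW/(hW _ _ hc) : (c - d *m S) *m M = 0.
  by rewrite mulmxBl -mulmxA SM hd subrr.
congr W; rewrite -addrA; congr (v + _).
rewrite -!sumrN -big_split /=; apply: eq_bigr => j _.
by rewrite !mxE scalerBl addKr.
Qed.

(** Exchange argument: a relation between the rows of the matrix expressing [b] in [b'] modulo [W]
    would be a relation between the [b i] modulo [W]. *)
Lemma quot_dim_leq U W m n :
  (forall x y, W x -> W y -> W (x + y)) -> (forall c x, W x -> W (c *: x)) ->
  W 0 -> quot_dim U W m -> quot_dim U W n -> (m <= n)%N.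
Proof.
move=> hD hZ h0 [b [Ub freeb _]] [b' [_ _ span']].
have /fin_all_exists[C hC] := fun i => span' (b i) (Ub i).
pose M : 'M[k]_(m, n) := \matrix_(i, j) C i j.
suff /eqP <- : row_free M by exact: rank_leq_col.
rewrite -kermx_eq0; apply/rowV0P => x /sub_kermxP hx.
apply/rowP => i; rewrite mxE; apply: (freeb (fun i => x 0 i)).
have -> : \sum_i x 0 i *: b i = \sum_i x 0 i *: (b i - \sum_j C i j *: b' j).
  under [RHS]eq_bigr => j _ do rewrite scalerBr scaler_sumr.
  rewrite big_split /= sumrN exchange_big /= [X in _ - X]big1 ?subr0 // => j _.
  under eq_bigr => l _ do rewrite scalerA.
  rewrite -scaler_suml; move/rowP/(_ j): hx; rewrite !mxE.
  by under eq_bigr => l _ do rewrite mxE; move=> ->; rewrite scale0r.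
by apply: (big_ind W) => // l _; apply/hZ/hC.
Qed.

Lemma quot_dim_uniq U W m n :
  (forall x y, W x -> W y -> W (x + y)) -> (forall c x, W x -> W (c *: x)) ->
  W 0 -> quot_dim U W m -> quot_dim U W n -> m = n.
Proof.
move=> hD hZ h0 hm hn; apply/eqP; rewrite eqn_leq.
by rewrite (quot_dim_leq hD hZ h0 hm hn) (quot_dim_leq hD hZ h0 hn hm).
Qed.

End QuotientDimension.

(** * The functional attached to [g] and its annihilator ideal *)

Section DualForm.
Local Open Scope ring_scope.
Variables (k : fieldType) (e r : nat).
Implicit Types (g : 'X_{1..r} -> k) (p q : {mpoly k[r]}).
Local Notation mon := (@mon e r).

Definition dual_form g p : k :=
  \sum_(a | mdeg (mon a) == e) p@_(mon a) * g (mon a).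

Lemma dual_form_is_linear g : linear_for *%R (dual_form g).
Proof.
move=> c p q; rewrite /dual_form mulr_sumr -big_split; apply: eq_bigr => a _ /=.
by rewrite mcoeffD mcoeffZ mulrDl mulrA.
Qed.

HB.instance Definition _ g :=
  GRing.isLinear.Build k {mpoly k[r]} k _ (dual_form g) (dual_form_is_linear g).

Lemma dual_formX g m : dual_form g 'X_[m] = if mdeg m == e then g m else 0.
Proof.
rewrite /dual_form; case: ifP => hm.
  have [a am] : exists a, mon a = m by apply: monP; rewrite (eqP hm).
  rewrite (bigD1 a) ?am //= mcoeffX eqxx mul1r big1 ?addr0 // => b /andP[_ ba].
  rewrite mcoeffX; case: eqP => [mb|]; last by rewrite mul0r.
  by rewrite (@mon_inj _ _ b a) ?eqxx // in ba; rewrite -mb.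
rewrite big1 // => a ha; rewrite mcoeffX; case: eqP => [ma|]; last by rewrite mul0r.
by rewrite ma ha in hm.
Qed.

Lemma dual_formE g p : dual_form g p = \sum_(m <- msupp p) p@_m * dual_form g 'X_[m].
Proof.
rewrite {1}[p]mpolyE linear_sum; apply: eq_bigr => m _; exact: linearZ.
Qed.

Lemma dual_formM g p q :
  dual_form g (p * q) = \sum_(m <- msupp p) p@_m * dual_form g ('X_[m] * q).
Proof.
rewrite {1}[p]mpolyE mulr_suml linear_sum; apply: eq_bigr => m _.
by rewrite -scalerAl; exact: linearZ.
Qed.

Lemma dual_form_mulX_gt g p m : (e < mdeg m)%N -> dual_form g (p * 'X_[m]) = 0.
Proof.
move=> em; rewrite dual_formM big1 // => n _; rewrite -mpolyXD dual_formX mdegD.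
by case: eqP => [?|_]; [lia | rewrite mulr0].
Qed.

(** Against a monomial of degree [e - d] only the component of degree [d] is visible; this makes
    [ann] homogeneous. *)
Lemma dual_form_pihomog g p d m :
  dual_form g (pihomog mdeg d p * 'X_[m]) =
  if (d + mdeg m == e)%N then dual_form g (p * 'X_[m]) else 0.
Proof.
have -> : pihomog mdeg d p = \sum_(n <- msupp p) p@_n *: pihomog mdeg d 'X_[n].
  by rewrite {1}[p]mpolyE linear_sum; apply: eq_bigr => n _; exact: linearZ.
rewrite mulr_suml linear_sum dual_formM.
have -> : (if (d + mdeg m == e)%N then
   \sum_(n <- msupp p) p@_n * dual_form g ('X_[n] * 'X_[m]) else 0) =
   \sum_(n <- msupp p) p@_n *
     (if (d + mdeg m == e)%N then dual_form g ('X_[n] * 'X_[m]) else 0).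
  by case: ifP => // _; rewrite big1 // => n _; rewrite mulr0.
apply: eq_bigr => n _; rewrite -scalerAl linearZ /=; congr (_ * _).
rewrite pihomogX; case: eqP => nd; last first.
  rewrite mul0r linear0 -mpolyXD dual_formX mdegD.
  by case: eqP => // <-; case: eqP => // /addIn.
by rewrite -mpolyXD dual_formX mdegD nd; case: ifP.
Qed.

(** Testing finitely many monomials keeps membership boolean; monomials of degree above [e] pair to
    zero, so [annP] recovers the condition on all multiples. *)
Definition ann g : {pred {mpoly k[r]}} :=
  fun p => [forall b, dual_form g (p * 'X_[mon b]) == 0].

Lemma annP g p : reflect (forall q, dual_form g (p * q) = 0) (p \in ann g).
Proof.
apply: (iffP forallP) => [h q|h b]; last by rewrite h.
rewrite mulrC dual_formM big1 // => m _; rewrite mulrC [_ * p]mulrC.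
have [em|] := ltnP e (mdeg m); first by rewrite dual_form_mulX_gt // mul0r.
by case/monP => b <-; rewrite (eqP (h b)) mul0r.
Qed.

Lemma ann_monP g p :
  reflect (forall m, (mdeg m <= e)%N -> dual_form g (p * 'X_[m]) = 0) (p \in ann g).
Proof.
apply: (iffP idP) => [/annP h m _|h]; first exact: h.
by apply/forallP => b; rewrite h ?mdeg_mon.
Qed.

Lemma ann0 g : 0 \in ann g.
Proof. by apply/annP => q; rewrite mul0r linear0. Qed.

Lemma annD g p q : p \in ann g -> q \in ann g -> p + q \in ann g.
Proof.
by move=> /annP hp /annP hq; apply/annP => x; rewrite mulrDl linearD /= hp hq addr0.
Qed.

Lemma annM g p q : q \in ann g -> p * q \in ann g.
Proof. by move=> /annP hq; apply/annP => x; rewrite mulrAC mulrC hq. Qed.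

Lemma ann_truncation g p :
  p - \sum_a p@_(mon a) *: 'X_[mon a] \in ann g.
Proof.
set d := p - _.
have d0 b : d@_(mon b) = 0.
  rewrite mcoeffB raddf_sum (bigD1 b) //= mcoeffZ mcoeffX eqxx mulr1.
  rewrite big1 ?addr0 ?subrr // => a ab; rewrite mcoeffZ mcoeffX.
  by rewrite (inj_eq (@mon_inj _ _)) (negPf ab) mulr0.
apply/annP => q; rewrite dual_formM big1 // => m _.
have [em|/monP[b <-]] := ltnP e (mdeg m); last by rewrite d0 mul0r.
by rewrite mulrC [X in dual_form g X]mulrC dual_form_mulX_gt // mul0r.
Qed.

(** Row [a] of the catalecticant lists the pairings of [u a] with monomials, and [ann] is the kernel
    of this pairing. Taking [u a = 0] outside degree [j] matches the zero rows. *)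
Lemma quot_dim_ann g j :
  quot_dim (fun p => p \is j.-homog) (fun p => p \in ann g) (\rank (catmx e g j)).
Proof.
pose u a : {mpoly k[r]} := if mdeg (mon a) == j then 'X_[mon a] else 0.
apply: (quot_dim_rank (u := u)) => [a|p q|p hp|c].
- by rewrite /u; case: ifP => h; rewrite ?dhomogX // dhomog0.
- exact: annD.
- exists (\row_a p@_(mon a)); suff -> : \sum_a (\row_a p@_(mon a)) 0 a *: u a =
      \sum_a p@_(mon a) *: 'X_[mon a] by exact: ann_truncation.
  apply: eq_bigr => a _; rewrite mxE /u.
  by case: ifPn => // ha; rewrite (dhomog_nemf_coeff hp ha) !scale0r.
have E b : dual_form g ((\sum_a c 0 a *: u a) * 'X_[mon b]) = (c *m catmx e g j) 0 b.
  rewrite mulr_suml linear_sum mxE; apply: eq_bigr => a _ /=.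
  rewrite -scalerAl linearZ /= mxE /u; congr (_ * _); case: ifP => _ /=.
    by rewrite -mpolyXD dual_formX mdegD.
  by rewrite mul0r linear0.
split=> [/forallP h|h]; first by apply/rowP => b; rewrite -E (eqP (h b)) mxE.
by apply/forallP => b; rewrite E h mxE.
Qed.

Lemma quot_dim_ann_total g : exists n, quot_dim (fun=> True) (fun p => p \in ann g) n.
Proof.
pose M : 'M[k]_#|{: 'X_{1..r < e.+1}}| :=
  \matrix_(a, b) dual_form g ('X_[mon a] * 'X_[mon b]).
exists (\rank M); apply: (quot_dim_rank (u := fun a => 'X_[mon a])) => [a|p q|p _|c] //.
- exact: annD.
- exists (\row_a p@_(mon a)); suff -> : \sum_a (\row_a p@_(mon a)) 0 a *: 'X_[mon a] =
      \sum_a p@_(mon a) *: 'X_[mon a] by exact: ann_truncation.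
  by apply: eq_bigr => a _; rewrite mxE.
have E b : dual_form g ((\sum_a c 0 a *: 'X_[mon a]) * 'X_[mon b]) = (c *m M) 0 b.
  rewrite mulr_suml linear_sum mxE; apply: eq_bigr => a _ /=.
  by rewrite -scalerAl linearZ /= mxE.
split=> [/forallP h|h]; first by apply/rowP => b; rewrite -E (eqP (h b)) mxE.
by apply/forallP => b; rewrite E h mxE.
Qed.

End DualForm.

(** * From functionals to Gorenstein algebras *)

Section Duality.
Local Open Scope ring_scope.
Variables (k : fieldType) (e r : nat).
Implicit Types (g : 'X_{1..r} -> k) (p q : {mpoly k[r]}).
Local Notation mon := (@mon e r).

Lemma mnm_pred (m : 'X_{1..r}) : m != 0%MM -> exists i n, m = (U_(i) + n)%MM.
Proof.
move=> m0; have [i hi] : exists i, m i != 0%N.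
  apply: NNPP => H; move/eqP: m0; apply; apply/mnmP => i; rewrite mnm0E.
  by apply/eqP; apply: contraT => h; case: H; exists i.
by exists i, (m - U_(i))%MM; rewrite addmC submK // lep1mP.
Qed.

Lemma irrelevantX i : irrelevant_ideal ('X_i : {mpoly k[r]}).
Proof.
exists (fun j => (j == i)%:R); rewrite (bigD1 i) //= eqxx mul1r.
by rewrite big1 ?addr0 // => j /negPf->; rewrite mul0r.
Qed.

Lemma dhomogXU i : ('X_i : {mpoly k[r]}) \is 1.-homog.
Proof. by rewrite dhomogX; apply/eqP/mdeg1. Qed.

Lemma mxrank_catmx0 g m : mdeg m = e -> g m != 0 -> \rank (catmx e g 0) = 1%N.
Proof.
move=> hm gm; have [a0 ha0] : exists a, mon a = 0%MM by apply: monP; rewrite mdeg0.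
have [b hb] : exists b, mon b = m by apply: monP; rewrite hm.
apply/eqP; rewrite eqn_leq; apply/andP; split; last first.
  rewrite lt0n mxrank_eq0; apply: contraNneq gm => /matrixP/(_ a0 b).
  by rewrite !mxE ha0 hb mdeg0 hm add0n !eqxx add0m /= => ->.
have -> : catmx e g 0 = (\col_a (a == a0)%:R) *m row a0 (catmx e g 0).
  apply/matrixP => a c; rewrite !mxE big_ord1 !mxE ha0 mdeg0 eqxx /=.
  rewrite mdeg_eq0 -ha0 (inj_eq (@mon_inj _ _)).
  case: eqP => [->|_]; last by rewrite mul0r.
  by rewrite mul1r ha0 mdeg0.
exact: leq_trans (mxrankM_maxl _ _) (rank_leq_col _).
Qed.

Lemma catmx_neq0 g j : catmx e g j != 0 -> exists2 m, mdeg m = e & g m != 0.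
Proof.
move=> h; apply: NNPP => H; move/eqP: h; apply; apply/matrixP => a b; rewrite !mxE.
case: ifP => // /andP[_ /eqP hab]; apply/eqP; apply: contraT => hg.
by case: H; exists (mon a + mon b)%MM; rewrite ?mdegD.
Qed.

(** The degree one catalecticant with rows indexed by the variables, so that rank [r] means free
    rows. *)
Definition linear_rows g : 'M[k]_(r, #|{: 'X_{1..r < e.+1}}|) :=
  \matrix_(i, b) dual_form e g ('X_i * 'X_[mon b]).

Lemma catmx1E g : catmx e g 1 = (\matrix_(a, i) (mon a == U_(i)%MM)%:R) *m linear_rows g.
Proof.
apply/matrixP => a b; rewrite !mxE.
under eq_bigr => i _ do rewrite !mxE -mpolyXD dual_formX.
rewrite mdeg_eq1; case: existsP => [[i /eqP hi]|H] /=; last first.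
  by rewrite big1 // => i _; case: eqP => [h|]; rewrite ?mul0r //; case: H; exists i; rewrite h.
rewrite hi (bigD1 i) //= eqxx mul1r mdegD big1 ?addr0 // => j ji.
by rewrite eq_mnm1 eq_sym (negPf ji) mul0r.
Qed.

Lemma mxrank_catmx1_leq g : (\rank (catmx e g 1) <= r)%N.
Proof. by rewrite catmx1E (leq_trans (mxrankM_maxl _ _)) // rank_leq_col. Qed.

Lemma homog1E (l : {mpoly k[r]}) : l \is 1.-homog -> l = \sum_i l@_U_(i) *: 'X_i.
Proof.
move=> hl; apply/mpolyP => m; rewrite raddf_sum /=.
under eq_bigr => i _ do rewrite mcoeffZ mcoeffX.
have [/mdeg1P[i /eqP ->]|m1] := boolP (mdeg m == 1%N).
  rewrite (bigD1 i) //= eqxx mulr1 big1 ?addr0 // => j ji.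
  by rewrite eq_mnm1 (negPf ji) mulr0.
rewrite (dhomog_nemf_coeff hl m1) big1 // => i _.
by case: eqP => [h|]; rewrite ?mulr0 // -h mdeg1 in m1 *.
Qed.

Lemma ann_no_linear_form g : \rank (catmx e g 1) = r ->
  forall l, l \is 1.-homog -> l \in ann e g -> l = 0.
Proof.
move=> hr l hl /annP lann.
have /row_free_inj inj : row_free (linear_rows g).
  rewrite -[row_free _]/(_ == _) eqn_leq rank_leq_row -{1}hr catmx1E.
  exact: mxrankM_maxr.
have /rowP l0 : \row_i l@_U_(i) = 0.
  apply: (inj 1%N); rewrite mul0mx; apply/rowP => b; rewrite !mxE.
  apply: etrans (lann (mpolyX k (mon b))).
  rewrite [in RHS](homog1E hl) mulr_suml linear_sum; apply: eq_bigr => i _ /=.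
  by rewrite !mxE -scalerAl linearZ.
by rewrite (homog1E hl) big1 // => i _; move/(_ i): l0; rewrite !mxE => ->; rewrite scale0r.
Qed.

(** A socle element pairs to zero with every nonconstant monomial, so its class is determined by its
    value under [dual_form]; the class of ['X_[m]] therefore spans the socle. *)
Lemma gorenstein_ann g m : mdeg m = e -> g m != 0 -> gorenstein (ann e g).
Proof.
move=> hm gm; exists (fun=> 'X_[m]); split=> [_ q [c ->]|c|p hp].
- apply/annP => q'; rewrite mulr_suml mulr_suml linear_sum big1 // => i _ /=.
  rewrite -[c i * _ * _]mulrA mulrAC -mpolyXD.
  by rewrite dual_form_mulX_gt // mdegD mdeg1 hm.
- rewrite big_ord1 => /annP/(_ 1); rewrite mulr1 linearZ /= dual_formX hm eqxx => /eqP.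
  by rewrite mulf_eq0 (negPf gm) orbF => /eqP c0 i; rewrite ord1.
exists (fun=> dual_form e g p / g m); rewrite big_ord1; apply/ann_monP => n _.
have [->|/mnm_pred[i [n' ->]]] := eqVneq n 0%MM.
  by rewrite mpolyX0 mulr1 linearB linearZ /= dual_formX hm eqxx divfK ?subrr.
rewrite mulrBl linearB /= -scalerAl linearZ /= [X in _ - _ * X](_ : _ = 0); last first.
  by rewrite -mpolyXD dual_formX !mdegD mdeg1 hm ifF //; lia.
rewrite mulr0 subr0 mpolyXD mulrA [p * _]mulrC.
exact: (annP _ _ _ (hp _ (irrelevantX i))).
Qed.

Lemma standard_graded_artinian_ann g m :
  mdeg m = e -> g m != 0 -> \rank (catmx e g 1) = r ->
  standard_graded_artinian (ann e g).
Proof.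
move=> hm gm hr; split.
- split=> [||a p q hp hq]; first exact: ann0.
    by apply/negP => /annP/(_ 'X_[m]); rewrite mul1r dual_formX hm eqxx; apply/eqP.
  exact/annD/hq/annM.
- move=> p /annP hp d; apply/ann_monP => n _.
  by rewrite dual_form_pihomog hp if_same.
- exact: ann_no_linear_form.
- exact: quot_dim_ann_total.
Qed.

(** Full rank in degree one excludes linear forms from [ann e g] and, since [r] is positive, forces
    [g] to be nonzero in degree [e]. *)
Lemma gorenstein_hf_catmx g : (0 < r)%N -> \rank (catmx e g 1) = r ->
  gorenstein_hf k e (fun j => \rank (catmx e g j)).
Proof.
move=> r0 hr; have [m hm gm] : exists2 m, mdeg m = e & g m != 0.
  by apply: (@catmx_neq0 _ 1); rewrite -mxrank_eq0 hr -lt0n.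
exists r, (ann e g); split.
- exact: standard_graded_artinian_ann hm gm hr.
- exact: gorenstein_ann hm gm.
- by move=> j; exact: quot_dim_ann.
split=> [|j ej]; last by rewrite catmx_gt // mxrank0.
by have := mxrank_catmx_sym g (leq0n e); rewrite subn0 (mxrank_catmx0 hm gm) => ->.
Qed.

End Duality.

(** * From Gorenstein algebras back to functionals *)

Section InverseSystem.
Local Open Scope ring_scope.
Variables (k : fieldType) (e r : nat) (I : {pred {mpoly k[r]}}) (h : nat -> nat).
Hypotheses (stdI : standard_graded_artinian I) (gorI : gorenstein I)
  (hfI : is_hilbert_function I h) (he : is_socle_degree h e).
Implicit Types p q : {mpoly k[r]}.

Let I0 : 0 \in I. Proof. by case: stdI => -[]. Qed.

Let ID p q : p \in I -> q \in I -> p + q \in I.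
Proof. by case: stdI => -[_ _ H] _ _ _ hp hq; rewrite -[p]mul1r; exact: H. Qed.

Let IM p q : q \in I -> p * q \in I.
Proof. by case: stdI => -[_ _ H] _ _ _ hq; rewrite -[_ * _]addr0; exact: H. Qed.

Let IZ c p : p \in I -> c *: p \in I.
Proof. by rewrite -mul_mpolyC; exact: IM. Qed.

Let IB p q : p \in I -> q \in I -> p - q \in I.
Proof. by move=> hp hq; rewrite -scaleN1r; exact/ID/IZ. Qed.

Let Isum (T : Type) (s : seq T) (P : pred T) (F : T -> {mpoly k[r]}) :
  (forall i, P i -> F i \in I) -> \sum_(i <- s | P i) F i \in I.
Proof. by move=> hF; apply: (big_ind (fun p => p \in I)). Qed.

Lemma ideal_above_socle p d : (e < d)%N -> p \is d.-homog -> p \in I.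
Proof.
move=> ed hp; have := hfI d; rewrite (he.2 _ ed) => -[b [_ _ /(_ p hp)[c]]].
by rewrite big_ord0 subr0.
Qed.

(** Forms of degree [e] are in the socle because degree [e.+1] lies in [I]; one outside [I] spans
    the one-dimensional socle. *)
Lemma socle_generator : exists b, [/\ b \is e.-homog, b \notin I &
  forall p, socle I p -> exists c, p - c *: b \in I].
Proof.
have [B [hB freeB _]] := hfI e.
pose i0 := Ordinal he.1; exists (B i0).
have bI : B i0 \notin I.
  apply/negP => bI; have H := freeB (fun i => (i == i0)%:R).
  suff /H/(_ i0)/eqP : \sum_i (i == i0)%:R *: B i \in I by rewrite eqxx oner_eq0.
  rewrite (bigD1 i0) //= scale1r big1 ?addr0 // => i /negPf ->.
  by rewrite scale0r.
split=> // p sp; have [s [_ _ spanS]] := gorI.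
have sb : socle I (B i0).
  move=> q [c ->]; rewrite mulr_suml; apply: Isum => i _.
  rewrite -mulrA; apply/IM/(@ideal_above_socle _ e.+1) => //.
  by rewrite -[e.+1]add1n; apply: dhomogM; [exact: dhomogXU | exact: hB].
have [c] := spanS _ sb; have [d] := spanS _ sp; rewrite !big_ord1 => hd hc.
have c0 : c ord0 != 0.
  by apply: contraNneq bI => c0; move: hc; rewrite c0 scale0r subr0.
exists (d ord0 / c ord0).
have -> : p - (d ord0 / c ord0) *: B i0 =
    (p - d ord0 *: s ord0) - (d ord0 / c ord0) *: (B i0 - c ord0 *: s ord0).
  by rewrite scalerBr scalerA divfK // opprB addrA subrK.
exact/IB/IZ.
Qed.

Lemma inverse_system : exists g, I =i ann e g.
Proof.
have [b [hb bI spanb]] := socle_generator.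
have socleX m : mdeg m = e -> exists c, 'X_[m] - c *: b \in I.
  move=> hm; apply: spanb => _ [c ->]; rewrite mulr_suml; apply: Isum => i _.
  rewrite -mulrA; apply/IM/(@ideal_above_socle _ e.+1) => //.
  rewrite -[e.+1]add1n; apply: dhomogM (dhomogXU _ _) _.
  by rewrite dhomogX; apply/eqP.
(* The coefficient of the class of ['X_[m]] on the socle generator; it exists in degree [e], the
   only degree that [dual_form] reads. *)
pose g m := epsilon (inhabits 0) (fun c => 'X_[m] - c *: b \in I).
exists g.
have gE m : mdeg m = e -> 'X_[m] - g m *: b \in I.
  by move=> /socleX; exact: epsilon_spec.
have dual_formE p : p \is e.-homog -> p - dual_form e g p *: b \in I.
  move=> hp; rewrite dual_formE scaler_suml {1}[p]mpolyE -sumrB big_seq.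
  apply: Isum => m mp; have hm : mdeg m = e := dhomog_mf hp mp.
  by rewrite dual_formX hm eqxx -scalerA -scalerBr; exact/IZ/gE.
have homI := let: And4 _ H _ _ := stdI in H.
(* A nonzero value on the degree [e] component of [p], itself in [I], would put [b] in [I]. *)
have form0 p : p \in I -> dual_form e g p = 0.
  move=> pI; have := dual_form_pihomog e g p e 0.
  rewrite mdeg0 addn0 eqxx mpolyX0 !mulr1 => <-.
  have := dual_formE _ (pihomogP mdeg e p); have := homI _ pI e.
  set q := pihomog _ _ _ => qI hq; apply/eqP; apply: contraNT bI => f0.
  have : dual_form e g q *: b \in I by rewrite -[_ *: b](subKr q); exact: IB.
  by move/(IZ (dual_form e g q)^-1); rewrite scalerA mulVf // scale1r.
(* Descending induction on the degree [n]; the truncated difference 0 covers all [n >= e]. Below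
   [e], the products of [p] with variables are already in [I], so [p] is in the socle. *)
have homog_ann n p : p \is n.-homog -> p \in ann e g -> p \in I.
  have [d] : exists d, d = (e - n)%N by exists (e - n)%N.
  elim: d n p => [|d IH] n p hd hp pann.
    have [en|ne] := ltnP e n; first exact: ideal_above_socle en hp.
    have nE : n = e by lia.
    rewrite nE in hp; have := dual_formE _ hp.
    by rewrite -[p in dual_form _ _ p]mulr1 (annP _ _ _ pann) scale0r subr0.
  have sp : socle I p.
    move=> _ [c ->]; rewrite mulr_suml; apply: Isum => i _; rewrite -mulrA.
    apply/IM/(IH n.+1); [by lia| |exact: annM].
    by rewrite -[n.+1]add1n; apply: dhomogM (dhomogXU _ _) hp.
  (* As [n < e], the degree [n] component of [p - c *: b] is [p]. *)
  have [c /homI/(_ n)] := spanb _ sp.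
  rewrite linearB linearZ /= (pihomog_dE hp) (pihomog_ne0 _ hb) ?scaler0 ?subr0 //.
  by apply/eqP => en; lia.
move=> p; apply/idP/idP => [pI|/annP pann].
  by apply/annP => q; apply: form0; rewrite mulrC; exact: IM.
rewrite (pihomog_partitionE (leqnn (msize p))); apply: Isum => d _.
apply: (homog_ann d); first exact: pihomogP.
by apply/ann_monP => m _; rewrite dual_form_pihomog pann if_same.
Qed.

Lemma hilbert_function_catmx : (0 < e)%N -> exists g : 'X_{1..r} -> k,
  [/\ (0 < r)%N, \rank (catmx e g 1) = r & forall j, h j = \rank (catmx e g j)].
Proof.
move=> e0; have [g Ig] := inverse_system; exists g.
have uniq U m n : quot_dim U (fun p => p \in I) m ->
    quot_dim U (fun p => p \in I) n -> m = n.
  exact: quot_dim_uniq.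
have hE j : h j = \rank (catmx e g j).
  apply: uniq (hfI j) _; have [b [hb fb sb]] := quot_dim_ann e g j.
  exists b; split=> // [c|u /sb[c hc]]; first by rewrite Ig; exact: fb.
  by exists c; rewrite Ig.
have h1 : h 1%N = r.
  apply: uniq (hfI 1%N) _; exists (fun i => 'X_i); split.
  - exact: dhomogXU.
  - move=> c; have [_ _ H _] := stdI => /H H'; move=> i.
    have /H'/mpolyP/(_ U_(i)%MM) : \sum_i c i *: 'X_i \is [in k[r], 1.-homog].
      by apply: rpred_sum => l _; exact/rpredZ/dhomogXU.
    rewrite mcoeff0 raddf_sum (bigD1 i) //= mcoeffZ mcoeffX eqxx mulr1.
    rewrite big1 ?addr0 // => l li.
    by rewrite mcoeffZ mcoeffX eq_mnm1 (negPf li) mulr0.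
  by move=> l /homog1E {1}->; exists (fun i => l@_U_(i)); rewrite subrr.
split=> //; last by rewrite -hE.
(* Without variables every monomial has degree 0, so no entry survives in degree [e > 0]. *)
rewrite lt0n; apply: contraTneq (he.1) => rE; rewrite -leqNgt hE.
rewrite leqn0 mxrank_eq0; apply: contraT => /catmx_neq0[m hm _].
move: e0; rewrite -hm mdegE big_pred0 // => i; have := ltn_ord i.
by rewrite [X in (_ < X)%N]rE.
Qed.

End InverseSystem.

(** * Adjoining variables, and power sums *)

Section Examples.
Local Open Scope ring_scope.
Variables (k : fieldType) (e : nat).

Section VariableExtension.
Variables (r s : nat) (rs : (r <= s)%N).

Definition mnm_restrict (m : 'X_{1..s}) : 'X_{1..r} :=
  [multinom m (widen_ord rs i) | i < r].

Definition mnm_extend (m : 'X_{1..r}) : 'X_{1..s} :=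
  (\sum_i U_(widen_ord rs i) *+ m i)%MM.

Lemma mdeg_extend m : mdeg (mnm_extend m) = mdeg m.
Proof.
by rewrite mdeg_sum mdegE; apply: eq_bigr => i _; rewrite mdegMn mdeg1 mul1n.
Qed.

Lemma mnm_extend_widen m i : mnm_extend m (widen_ord rs i) = m i.
Proof.
rewrite mnm_sumE (bigD1 i) //= mulmnE mnm1E eqxx mul1n big1 ?addn0 // => j ji.
by rewrite mulmnE mnm1E -val_eqE /= val_eqE (negPf ji).
Qed.

(** The submatrix indexed by the extended monomials is the original catalecticant. *)
Lemma mxrank_catmx_restrict (g : 'X_{1..r} -> k) j :
  (\rank (catmx e g j) <= \rank (catmx e (g \o mnm_restrict) j))%N.
Proof.
have /fin_all_exists[u hu] : forall a : 'I_#|{: 'X_{1..r < e.+1}}|,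
    exists b, @mon e s b = mnm_extend (mon a).
  by move=> a; apply: monP; rewrite mdeg_extend mdeg_mon.
suff -> : catmx e g j = mxsub u u (catmx e (g \o mnm_restrict) j).
  exact: mxrank_mxsub.
apply/matrixP => a b; rewrite !mxE !hu !mdeg_extend /=.
suff -> : mnm_restrict (mnm_extend (mon a) + mnm_extend (mon b)) = (mon a + mon b)%MM.
  by [].
by apply/mnmP => i; rewrite mnmE !mnmDE !mnm_extend_widen.
Qed.

End VariableExtension.

(* The evaluation at the i-th coordinate vector is
   [m |-> (mdeg m == m i)%:R], so this is the dual form of the power sum. *)
Definition power_sum r (m : 'X_{1..r}) : k := \sum_i (mdeg m == m i)%:R.

(** Above, the matrix factors through dimension [r]; below, the rows x_i^j and the columns x_l^(e-j)
    cut out an identity matrix. *)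
Lemma mxrank_power_sum r j : (0 < j < e)%N -> \rank (catmx e (@power_sum r) j) = r.
Proof.
case/andP => j0 je; apply/eqP; rewrite eqn_leq; apply/andP; split.
  pose C : 'M[k]_(_, r) := \matrix_(a, i)
    if mdeg (@mon e r a) == j then (mdeg (mon a) == mon a i)%:R else 0.
  pose D : 'M[k]_(r, _) := \matrix_(i, b)
    if (j + mdeg (@mon e r b) == e)%N then (mdeg (mon b) == mon b i)%:R else 0.
  suff -> : catmx e (@power_sum r) j = C *m D.
    exact: leq_trans (mxrankM_maxl _ _) (rank_leq_col _).
  apply/matrixP => a b; rewrite !mxE.
  under [RHS]eq_bigr => i _ do rewrite !mxE.
  case: eqP => [aj|_] /=; last by rewrite big1 // => i _; rewrite mul0r.
  rewrite {1}aj; case: ifP => _; last by rewrite big1 // => i _; rewrite mulr0.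
  (* Exponents never exceed the degree, so equality for the product forces equality for both
     factors. *)
  apply: eq_bigr => i _; rewrite -natrM mulnb mdegD mnmDE; congr (_%:R); congr nat_of_bool.
  have := mnm_leq_mdeg (mon a) i; have := mnm_leq_mdeg (mon b) i.
  by move: (mdeg (mon a)) (mdeg (mon b)) => x y; lia.
have mE (i t : 'I_r) n : (U_(i) *+ n)%MM t = ((i == t) * n)%N by rewrite mulmnE mnm1E.
have dE (i : 'I_r) n : mdeg (U_(i) *+ n) = n by rewrite mdegMn mdeg1 mul1n.
have /fin_all_exists[u hu] : forall i : 'I_r, exists a, @mon e r a = (U_(i) *+ j)%MM.
  by move=> i; apply: monP; rewrite dE ltnW.
have /fin_all_exists[v hv] : forall i : 'I_r, exists a, @mon e r a = (U_(i) *+ (e - j))%MM.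
  by move=> i; apply: monP; rewrite dE leq_subr.
suff rE : \rank (mxsub u v (catmx e (@power_sum r) j)) = r.
  by rewrite -[X in (X <= _)%N]rE; exact: mxrank_mxsub.
rewrite -[RHS](mxrank1 k r); congr mxrank; apply/matrixP => i l.
rewrite !mxE hu hv !dE eqxx subnKC ?eqxx 1?ltnW //=.
rewrite /power_sum (bigD1 i) //= big1 ?addr0 => [|t ti].
  rewrite mdegD !dE mnmDE !mE eqxx [l == i]eq_sym; congr (_%:R).
  by case: (i == l); lia.
rewrite mdegD !dE mnmDE !mE [i == t]eq_sym (negPf ti).
by rewrite [X in nat_of_bool X](_ : _ = false) //; case: (l == t); lia.
Qed.

End Examples.

(** * Attained pairs (h_1, h_2), and the equivalence *)

Section HilbertFunctions.
Variables (k : fieldType) (e : nat).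
Definition symmetric_vector h :=
  [/\ h 0 = 1, forall j, j <= e -> h (e - j) = h j & forall j, e < j -> h j = 0].

Lemma raise_symmetric h i b : 1 <= i <= e - 1 -> symmetric_vector h ->
  symmetric_vector (raise e i b h).
Proof.
move=> hi [h0 hsym hgt]; rewrite /raise; split=> [|j je|j ej].
- by rewrite h0; case: ifP => //; lia.
- have -> : (e - j == i) || (e - j == e - i) = (j == i) || (j == e - i) by lia.
  by rewrite hsym.
- by rewrite hgt //; case: ifP => //; lia.
Qed.

(** For these [e], an index [j] with [2 < j <= e] has mirror image [e - j <= 2]. *)
Lemma symmetric_vector_ext h h' : e = 4 \/ e = 5 ->
  symmetric_vector h -> symmetric_vector h' ->
  h 1 = h' 1 -> h 2 = h' 2 -> h =1 h'.
Proof.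
move=> he [h0 hs hg] [h0' hs' hg'] h1 h2.
have low j : j <= 2 -> h j = h' j by case: j => [|[|[|]]] //; rewrite h0 h0'.
move=> j; have [ej|je] := ltnP e j; first by rewrite hg // hg'.
have [|j2] := leqP j 2; first exact: low.
by rewrite -hs // -hs' //; apply: low; lia.
Qed.

Hypothesis e_gt0 : 0 < e.

Lemma eq_gorenstein_hf h h' : h =1 h' -> gorenstein_hf k e h -> gorenstein_hf k e h'.
Proof.
move=> hh' [r [I [stdI gorI hfI [he0 he]]]]; exists r, I; split=> //.
  by move=> j; rewrite -hh'.
by split=> [|j ej]; rewrite -hh' // he.
Qed.

Lemma gorenstein_hfP h : gorenstein_hf k e h -> 
  exists r (g : 'X_{1..r} -> k),
    [/\ 0 < r, h 1 = r & forall j, h j = \rank (catmx e g j)].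
Proof.
move=> [r [I [stdI gorI hfI he]]].
have [g [r0 gr hE]] := hilbert_function_catmx stdI gorI hfI he e_gt0.
by exists r, g; rewrite hE.
Qed.

Lemma gorenstein_hf_symmetric h : gorenstein_hf k e h -> symmetric_vector h.
Proof.
move=> /gorenstein_hfP[r [g [r0 h1 hE]]]; split=> [|j je|j ej]; rewrite !hE.
- have [m hm gm] : exists2 m, mdeg m = e & g m != 0%R.
    by apply: (@catmx_neq0 _ _ _ _ 1); rewrite -mxrank_eq0 -hE h1 -lt0n.
  exact: mxrank_catmx0 hm gm.
- exact: mxrank_catmx_sym.
by rewrite catmx_gt // mxrank0.
Qed.

Definition attains r a := exists h : nat -> nat,
  [/\ gorenstein_hf k e h, h 0 = 1, h 1 = r & h 2 = a].

(** Splitting off two variables from a monomial of degree [e] where [g] is nonzero gives a nonzero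
    entry of [catmx e g 2]. *)
Lemma attains_gt0 r a : 2 <= e -> attains r a -> 0 < a.
Proof.
move=> e2 [h [/gorenstein_hfP[n0 [g [r0 h1 hE]]] _ _ <-]].
rewrite hE lt0n mxrank_eq0.
have [m hm gm] : exists2 m, mdeg m = e & g m != 0%R.
  by apply: (@catmx_neq0 _ _ _ _ 1); rewrite -mxrank_eq0 -hE h1 -lt0n.
have [i [n mE]] : exists i n, m = (U_(i) + n)%MM.
  by apply: mnm_pred; rewrite -mdeg_eq0 hm; lia.
have [l [n' nE]] : exists i n', n = (U_(i) + n')%MM.
  apply: mnm_pred; rewrite -mdeg_eq0; move: hm; rewrite mE mdegD mdeg1; lia.
rewrite mE nE addmA in hm gm.
have [c hc] : exists c, @mon e _ c = (U_(i) + U_(l))%MM.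
  by apply: monP; rewrite mdegD !mdeg1.
have [b hb] : exists b, @mon e _ b = n' by apply: monP; rewrite -hm mdegD leq_addl.
apply: contraNneq gm => /matrixP/(_ c b); rewrite !mxE hc hb -mdegD hm.
by rewrite mdegD !mdeg1 !eqxx /= => ->.
Qed.

Lemma attains_diag r : 3 <= e -> 0 < r -> attains r r.
Proof.
move=> e3 r0; exists (fun j => \rank (catmx e (@power_sum k r) j)).
have hf : gorenstein_hf k e (fun j => \rank (catmx e (@power_sum k r) j)).
  by apply: gorenstein_hf_catmx; rewrite // mxrank_power_sum; lia.
have [h0 _ _] := gorenstein_hf_symmetric hf.
by split=> //; rewrite mxrank_power_sum; lia.
Qed.

Lemma attains_between r s a b c : [pchar k]%R =i pred0 ->
  attains s a -> attains r c -> r <= s -> a <= b <= c -> attains s b.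
Proof.
move=> k0 [h [/gorenstein_hfP[s' [g [s0 h1 hE]]] _ h1s h2]].
move=> [h' [/gorenstein_hfP[r' [g' [_ h1' hE']]] _ h1r h2']] rs abc.
have sE : s' = s by rewrite -h1.
have rE : r' = r by rewrite -h1'.
case: _ / sE rs h1s => rs h1s; case: _ / rE rs => rs.
have [|g'' r1 r2] := @catmx_interpolation _ e _ k0 g (g' \o mnm_restrict rs) 1 2 b.
  case/andP: abc => ab bc; rewrite -hE h2 ab (leq_trans bc) // -h2' hE'.
  exact: mxrank_catmx_restrict.
(* Interpolation only keeps this rank from dropping; the number of variables caps it. *)
have r1E : \rank (catmx e g'' 1) = s'.
  by apply/eqP; rewrite eqn_leq mxrank_catmx1_leq -{1}h1 hE.
have hf := gorenstein_hf_catmx s0 r1E.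
by exists (fun j => \rank (catmx e g'' j)); have [] := gorenstein_hf_symmetric hf.
Qed.

(** By [attains_diag] the set of attained values is nonempty, so the epsilon in [f] picks its least
    element. Excluded middle makes [attains] boolean for [ex_minnP]. *)
Lemma f_least r : 3 <= e -> 0 < r -> is_least (attains r) (f k e r).
Proof.
move=> e3 r0; apply: (epsilon_spec (inhabits 0)).
have h : exists n, (if excluded_middle_informative (attains r n) then true else false).
  by exists r; case: excluded_middle_informative => //= -[]; exact: attains_diag.
have [n hn nmin] := ex_minnP h; exists n; split.
  by move: hn; case: excluded_middle_informative.
by move=> b hb; apply: nmin; case: excluded_middle_informative.
Qed.

End HilbertFunctions.

Theorem proposition3p1 (k : fieldType) (e : nat)
    (hk : [pchar k]%R =i pred0) (he : e = 4 \/ e = 5) :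
  GIC k e <->
  (forall r s : nat, 0 < r -> r <= s -> f k e r <= f k e s).
Proof.
have e0 : 0 < e by lia.
have e3 : 3 <= e by lia.
split=> [gic r s r0 rs|fmono i a h hi a2 h0 _ hfh hfa b hb].
  rewrite leqNgt; apply/negP => fsr; set a := f k e s in fsr.
  have [_ rmin] := f_least k e0 e3 r0.
  have [sa _] := f_least k e0 e3 (leq_trans r0 rs).
  have ar : a < r := leq_trans fsr (rmin _ (attains_diag k e0 e3 r0)).
  have rs' : r < s.
    rewrite ltn_neqAle rs andbT; apply/eqP => rsE.
    by rewrite /a rsE ltnn in fsr.
  have a0 : 0 < a by apply: attains_gt0 sa; lia.
  have [h [hfh h0 h1 h2]] := attains_diag k e0 e3 a0.
  have [hs [hfs hs0 hs1 hs2]] := sa.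
  have hsym := gorenstein_hf_symmetric e0 hfh.
  have hi : 1 <= 1 <= e - 1 by lia.
  have he1 : h e = 1 by case: hsym => _ /(_ 0 isT); rewrite subn0 h0.
  (* The raised vector is [hs]: both have h_1 = [s] and h_2 = [a], since the raised degrees 1 and
     [e - 1] avoid 2. *)
  have hfr : gorenstein_hf k e (raise e 1 (s - a) h).
    apply: (eq_gorenstein_hf _ hfs); apply: (symmetric_vector_ext he).
    - exact: gorenstein_hf_symmetric hfs.
    - exact: raise_symmetric.
    - by rewrite /raise /= hs1 h1; lia.
    - by rewrite /raise hs2 h2 ifF //; lia.
  have /rmin : attains k e r a.
    exists (raise e 1 (r - a) h); split.
    - apply: gic hfr _ _; rewrite // ; lia.
    - by rewrite /raise h0 ifF //; lia.
    - by rewrite /raise /= h1; lia.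
    - by rewrite /raise h2 ifF //; lia.
  by rewrite leqNgt fsr.
have hsym := gorenstein_hf_symmetric e0 hfh.
have raise_attains c : gorenstein_hf k e (raise e i c h) ->
    attains k e (raise e i c h 1) (raise e i c h 2).
  by move=> hfc; exists (raise e i c h); split=> //; rewrite /raise h0 ifF //; lia.
have attains_raise : attains k e (raise e i b h 1) (raise e i b h 2) ->
    gorenstein_hf k e (raise e i b h).
  move=> [h' [hf' _ h1' h2']]; apply: (eq_gorenstein_hf _ hf').
  apply: (symmetric_vector_ext he) => //; first exact: gorenstein_hf_symmetric hf'.
  exact: raise_symmetric.
apply: attains_raise.
have hA : attains k e (h 1) (h 2) by exists h.
have h10 : 0 < h 1 by have [r [g [r0 -> _]]] := gorenstein_hfP e0 hfh.
have := raise_attains _ hfa; rewrite /raise.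
(* For [e] equal to 4 or 5, exactly one of the degrees 1 and 2 is raised. *)
have [i1|i1] := boolP ((1 == i) || (1 == e - i)).
  have -> : (2 == i) || (2 == e - i) = false by lia.
  move=> ha.
  have [hb1 _] : is_least (attains k e (h 1 + b)) (f k e (h 1 + b)).
    by apply: f_least => //; lia.
  have [_ amin] : is_least (attains k e (h 1 + a)) (f k e (h 1 + a)).
    by apply: f_least => //; lia.
  (* Monotonicity gives f(h_1 + b) <= f(h_1 + a) <= h_2, and h_2 is attained with the fewer
     variables h_1. *)
  apply: (attains_between e0 hk hb1 hA); first exact: leq_addr.
  by rewrite leqnn andbT (leq_trans _ (amin _ ha)) // fmono; lia.
have -> : (2 == i) || (2 == e - i) by lia.
(* Here h_1 is fixed, and h_2 + b lies between the attained values h_2 and h_2 + a. *)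
move=> ha; apply: (attains_between e0 hk hA ha (leqnn _)); lia.
Qed.
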